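(* Let $\pi$ be a $d_1\times\dots\times d_p$ probability tensor corresponding to a weakly hierarchical log-linear model with parameters $\theta$, and assume $C_\theta^{(j)}\neq\emptyset$ for all $j\in V=\{1,\dots,p\}$. For $H=\{H_1,\dots,H_p\}$ with each $H_j\subset\mathcal I_j$, define $$T_{(C_\theta,H)}=\{(E,\boldsymbol i_E)\in C_\theta : i_j\in H_j\text{ for some } j\in E\},\qquad \mathscr H=\{H : T_{(C_\theta,H)}=C_\theta\}.$$ Then $$\mathrm{rnk}^+_P(\pi)\le\min_{H\in\mathscr H}\ \prod_{j\in V}(|H_j|+1).$$ Moreover, when $d_1=\dots=d_p=d$, setting, for $l\in V$ and $H\in\mathscr H$, $W_l=\{j\in V\setminus\{l\}: |H_j|=d-1\}$ and $\bar W_l=V\setminus W_l$, one has $$\mathrm{rnk}^+_P(\pi)\le \min_{H\in\mathscr H}\ \min_{l\in V}\left(\prod_{j\in V}(|H_j|+1)-\Bigl[\prod_{j\in W_l}(|H_j|+1)\Bigr]\Bigl[\prod_{j\in\bar W_l}|H_j|\Bigr]\right),$$ and this last upper bound is tight, i.e. it cannot be globally improved over the class of weakly hierarchical log-linear models: there is a probability tensor corresponding to a weakly hierarchical log-linear model (satisfying the assumptions above) for which equality holds.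
   Context: Notation. $V=\{1,\dots,p\}$ indexes categorical variables $y_1,\dots,y_p$; $y_j$ takes values in $\mathcal I_j=\{1,\dots,d_j\}$. For $E\subset V$, $\mathcal I_E=\prod_{j\in E}\mathcal I_j$, and for $\boldsymbol i=(i_1,\dots,i_p)\in\mathcal I_V$, $\boldsymbol i_E=(i_j)_{j\in E}$. A probability tensor is an array $\pi=(\pi_{\boldsymbol i})_{\boldsymbol i\in\mathcal I_V}$ of nonnegative numbers summing to one, with $\pi_{i_1\dots i_p}=\Pr(y_1=i_1,\dots,y_p=i_p)$. Empty products equal $1$. Log-linear model. $\pi$ corresponds to a log-linear model with real parameters $\theta=\{\theta_E(\boldsymbol i_E)\}$ if $\log \pi_{\boldsymbol i}=\sum_{E\subset V}\theta_E(\boldsymbol i_E)$ for all $\boldsymbol i\in\mathcal I_V$, with the corner parameterization: $\theta_E(\boldsymbol i_E)=0$ whenever $i_j=1$ for some $j\in E$. Weakly hierarchical. The model is weakly hierarchical if: whenever $\theta_E(\boldsymbol i_E)=0$ for some $E\subset V$ and $\boldsymbol i_E\in\mathcal I_E$, then $\theta_F(\boldsymbol i'_F)=0$ for every $F\supseteq E$ and every $\boldsymbol i'_F\in\mathcal I_F$ with $i'_j=i_j$ for all $j\in E$. Interaction sets. $C_\theta=\{(E,\boldsymbol i_E): |E|\ge 2,\ \theta_E(\boldsymbol i_E)\neq 0\}$ is the set of nonzero two-way or higher interactions, and for $j\in V$, $C_\theta^{(j)}=\{c_j\in\mathcal I_j : \text{there exist } j'\neq j \text{ and } c_{j'}\in\mathcal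 I_{j'} \text{ such that } \theta_{\{j,j'\}}(c_j,c_{j'})\neq 0\}$. Nonnegative PARAFAC rank. For a nonnegative tensor $M\in\mathbb R^{d_1\times\dots\times d_p}$, $\mathrm{rnk}^+_P(M)$ is the least $m$ such that $M=\sum_{h=1}^m \lambda_h^{(1)}\otimes\dots\otimes\lambda_h^{(p)}$ with nonnegative vectors $\lambda_h^{(j)}\in\mathbb R^{d_j}$, where $\otimes$ is the outer product. *)

(* Defs.v *)
From HB Require Import structures.
From mathcomp Require Import all_boot all_order all_algebra.
From mathcomp Require Import all_classical all_reals all_analysis.

Set Implicit Arguments.
Unset Strict Implicit.
Unset Printing Implicit Defensive.

Import Order.TTheory GRing.Theory Num.Theory.

Local Open Scope ring_scope.

(* The default value is only a filler: it is never smaller than a value [F x],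
   so it is irrelevant as soon as [P] is satisfiable (see [minoverP]). *)
Definition minover (T : finType) (P : pred T) (F : T -> nat) : nat :=
  \big[minn/(\max_(x : T) F x)%N]_(x | P x) F x.

Lemma minoverP (T : finType) (P : pred T) (F : T -> nat) (x0 : T) : P x0 ->
  (exists2 x, P x & minover P F = F x) /\
  (forall x, P x -> (minover P F <= F x)%N).
Proof.
move=> Px0.
have le_min x : P x -> (minover P F <= F x)%N.
  rewrite /minover; move: (\max_(y : T) F y)%N (mem_index_enum x); move=> m0.
  elim: (index_enum T) => // y s ih.
  rewrite inE big_cons => /predU1P[<- Px|/ih{}ih Px]; first by rewrite Px geq_minl.
  by case: ifP => _; rewrite ?ih // geq_min ih ?orbT.
split=> //.
have : minover P F = (\max_(x : T) F x)%N \/ exists2 x, P x & minover P F = F x.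
  rewrite /minover; apply: (big_ind (fun m => m = (\max_(x : T) F x)%N \/
      exists2 x, P x & m = F x)) => [|a b ha hb|x Px]; first by left.
  - by rewrite /minn; case: ifP.
  - by right; exists x.
case=> [e|//]; exists x0 => //; apply/eqP; rewrite eqn_leq le_min //=.
by rewrite e leq_bigmax.
Qed.

(* The variables are indexed by ['I_p] and the [d j] levels of variable [j] by
   ['I_(d j)]; the reference level, written 1 in the usual notation, is the
   ordinal of value 0. *)

Definition margin (p : nat) (d : 'I_p -> nat) (E : {set 'I_p}) : finType :=
  {dffun forall j : {j : 'I_p | j \in E}, 'I_(d (val j))}.

Definition cell (p : nat) (d : 'I_p -> nat) : finType :=
  {dffun forall j : 'I_p, 'I_(d j)}.

Definition restr (p : nat) (d : 'I_p -> nat) (E : {set 'I_p}) (i : cell d) :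
  margin d E := [ffun j : {j : 'I_p | j \in E} => i (val j)].

Definition tensor (R : realType) (p : nat) (d : 'I_p -> nat) : Type :=
  cell d -> R.

Definition parameters (R : realType) (p : nat) (d : 'I_p -> nat) : Type :=
  forall E : {set 'I_p}, margin d E -> R.

Definition probability_tensor (R : realType) (p : nat) (d : 'I_p -> nat)
    (pi : tensor R d) : Prop :=
  (forall i, 0 <= pi i) /\ \sum_i pi i = 1.

Definition corner (R : realType) (p : nat) (d : 'I_p -> nat)
    (theta : parameters R d) : Prop :=
  forall (E : {set 'I_p}) (e : margin d E),
    (exists j, e j = 0%N :> nat) -> theta E e = 0.

(* Positivity is explicit because [ln 0 = 0] in the library. *)
Definition log_linear (R : realType) (p : nat) (d : 'I_p -> nat)
    (pi : tensor R d) (theta : parameters R d) : Prop :=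
  corner theta /\
  forall i : cell d, 0 < pi i /\
    ln (pi i) = \sum_(E : {set 'I_p}) theta E (restr E i).

Definition weakly_hierarchical (R : realType) (p : nat) (d : 'I_p -> nat)
    (theta : parameters R d) : Prop :=
  forall (E : {set 'I_p}) (e : margin d E), theta E e = 0 ->
  forall (F : {set 'I_p}) (f : margin d F), E \subset F ->
    (forall (j : 'I_p) (jE : j \in E) (jF : j \in F),
       f (exist _ j jF) = e (exist _ j jE)) ->
    theta F f = 0.

Definition interactions (R : realType) (p : nat) (d : 'I_p -> nat)
    (theta : parameters R d) : {set {E : {set 'I_p} & margin d E}} :=
  [set x : {E : {set 'I_p} & margin d E} |
    (2 <= #|tag x|)%N && (theta (tag x) (tagged x) != 0)].

(* The element [e] is the pair (c, c') seen as an index over [{j, j'}]. *)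
Definition interacting_levels (R : realType) (p : nat) (d : 'I_p -> nat)
    (theta : parameters R d) (j : 'I_p) : {set 'I_(d j)} :=
  [set c : 'I_(d j) | [exists j' : 'I_p, (j' != j) &&
    [exists c' : 'I_(d j'), exists e : margin d [set j; j'],
      [&& e (exist _ j (set21 j j')) == c,
          e (exist _ j' (set22 j j')) == c' &
          theta [set j; j'] e != 0]]]].

Definition level_sets (p : nat) (d : 'I_p -> nat) : finType :=
  {dffun forall j : 'I_p, {set 'I_(d j)}}.

Definition touched (R : realType) (p : nat) (d : 'I_p -> nat)
    (theta : parameters R d) (H : level_sets d) :
    {set {E : {set 'I_p} & margin d E}} :=
  [set x in interactions theta |
    [exists j : {j : 'I_p | j \in tag x}, tagged x j \in H (val j)]].

Definition covering (R : realType) (p : nat) (d : 'I_p -> nat)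
    (theta : parameters R d) : {set level_sets d} :=
  [set H | touched theta H == interactions theta].

Definition nonneg_parafac (R : realType) (p : nat) (d : 'I_p -> nat)
    (M : tensor R d) (m : nat) : Prop :=
  exists lambda : 'I_m -> forall j : 'I_p, 'I_(d j) -> R,
    (forall h j c, 0 <= lambda h j c) /\
    (forall i : cell d, M i = \sum_(h < m) \prod_(j < p) lambda h j (i j)).

(* [nonneg_rankP] shows that the default value 0 is not used for nonnegative
   tensors of order at least one. *)
Definition nonneg_rank (R : realType) (p : nat) (d : 'I_p -> nat)
    (M : tensor R d) : nat :=
  xget 0%N [set m : nat | nonneg_parafac M m /\
                          forall k, nonneg_parafac M k -> (m <= k)%N]%classic.

Lemma nonneg_rankP (R : realType) (p : nat) (d : 'I_p -> nat)
    (M : tensor R d) : (0 < p)%N -> (forall i, 0 <= M i) ->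
  nonneg_parafac M (nonneg_rank M) /\
  (forall k, nonneg_parafac M k -> (nonneg_rank M <= k)%N).
Proof.
move=> p0 M0; rewrite /nonneg_rank.
apply: (@xgetPex _ 0%N [set m : nat | nonneg_parafac M m /\
  forall k, nonneg_parafac M k -> (m <= k)%N]%classic).
suff ex : exists m, `[< nonneg_parafac M m >].
  exists (ex_minn ex); case: ex_minnP => m /asboolP hm min_m.
  by split=> // k hk; apply/min_m/asboolP.
pose j0 := Ordinal p0; exists #|{: cell d}|; apply/asboolP.
exists (fun h j c =>
  ((c == (enum_val h : cell d) j)%:R * (if j == j0 then M (enum_val h) else 1))).
split=> [h j c|i]; first by rewrite mulr_ge0 // ?ler0n //; case: ifP.
have -> : M i = \sum_(k : cell d) (k == i)%:R * M k.
  rewrite (bigD1 i) //= eqxx mul1r big1 ?addr0 // => k /negPf ->.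
  by rewrite mul0r.
rewrite (reindex (enum_val : 'I_#|{: cell d}| -> cell d)) /=; last first.
  by exists enum_rank => k _; rewrite ?enum_valK ?enum_rankK.
apply: eq_bigr => h _; rewrite big_split /=; congr (_ * _); last first.
  by rewrite (bigD1 j0) //= ?eqxx big1 ?mulr1 // => j /negPf ->.
have [->|ne] := eqVneq (enum_val h : cell d) i.
  by rewrite ?eqxx big1 // => j _; rewrite eqxx.
have /existsP [j jP] : [exists j, i j != (enum_val h : cell d) j].
  apply: contraNT ne; rewrite negb_exists => /forallP ij.
  by apply/eqP/ffunP => j; apply/esym/eqP; move: (ij j); rewrite negbK.
by rewrite (bigD1 j) //= (negPf jP) mul0r.
Qed.

Definition saturated_levels (p : nat) (d : 'I_p -> nat) (n : nat)
    (H : level_sets d) (l : 'I_p) : {set 'I_p} :=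
  [set j in ~: [set l] | #|H j| == (n - 1)%N].

Definition bound (p : nat) (d : 'I_p -> nat) (H : level_sets d) : nat :=
  (\prod_(j < p) (#|H j| + 1))%N.

(* The truncated subtraction is exact: since [#|H j| <= #|H j| + 1], the
   subtrahend never exceeds [bound H]. *)
Definition sharp_bound (p : nat) (d : 'I_p -> nat) (n : nat)
    (H : level_sets d) (l : 'I_p) : nat :=
  let W := saturated_levels n H l in
  (bound H - (\prod_(j in W) (#|H j| + 1)) * \prod_(j in ~: W) #|H j|)%N.

(* Main.v *)
(* Fix H and, for each variable j, keep the levels in H_j apart and merge all the
   others into one class. The cells then split into prod_j (|H_j| + 1) boxes. If a
   nonzero interaction involved two merged coordinates, so would a nonzero two-way
   interaction, by hierarchy, and H would miss it; so on each box log pi is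
   a sum of functions of single coordinates, i.e. pi has rank one there.
   For the sharper bound, boxes reduced to one cell are grouped into fibers along
   the coordinate l.
   Tightness: on a 2 x 2 table with a nonzero interaction the determinant does not
   vanish, so the rank is 2, while taking for H_1 the non-reference level and H_2
   empty gives the bound 2. *)
Require Import Defs.
From HB Require Import structures.
From mathcomp Require Import all_boot all_order all_algebra.
From mathcomp Require Import all_classical all_reals all_analysis.
From mathcomp Require Import ring.

Set Implicit Arguments.
Unset Strict Implicit.
Unset Printing Implicit Defensive.

Import Order.TTheory GRing.Theory Num.Theory.

Local Open Scope ring_scope.

(** * Partitions into rank-one boxes *)

Definition rank_one_on (R : realType) (p : nat) (d : 'I_p -> nat)
    (M : tensor R d) (B : forall j, {set 'I_(d j)}) : Prop :=
  exists mu : forall j, 'I_(d j) -> R, (forall j c, 0 <= mu j c) /\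
    forall i : cell d, i \in setXn B -> M i = \prod_(j < p) mu j (i j).

(** Each box contributes one term: its product form cut off by the indicators of its sides. The
    boxes indexed by [G] partition the cells, so at [i] only the term of [h i] survives. *)
Lemma nonneg_parafac_boxes (R : realType) (p : nat) (d : 'I_p -> nat)
    (M : tensor R d) (I : finType) (G : {set I})
    (B : I -> forall j, {set 'I_(d j)}) (h : cell d -> I) :
  (forall i, h i \in G) ->
  (forall i g, g \in G -> (i \in setXn (B g)) = (g == h i)) ->
  (forall g, g \in G -> rank_one_on M (B g)) ->
  nonneg_parafac M #|G|.
Proof.
move=> hG hB rG.
have /choice[mu muP] (k : 'I_#|G|) := rG _ (enum_valP k).
exists (fun k j c => (c \in B (enum_val k) j)%:R * mu k j c); split.
  by move=> k j c; rewrite mulr_ge0 ?ler0n //; case: (muP k).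
move=> i; pose k := enum_rank_in (hG i) (h i).
have ik : i \in setXn (B (enum_val k)).
  by rewrite hB ?enum_valP // enum_rankK_in.
rewrite (muP k).2 // (bigD1 k) //= -[LHS]addr0; congr (_ + _).
  apply: eq_bigr => j _.
  by move/setXnP: ik => ->; rewrite mul1r.
rewrite big1 // => k' kk'; have : i \notin setXn (B (enum_val k')).
  rewrite hB ?enum_valP //; apply: contra_neqN kk' => /eqP kh.
  by apply: enum_val_inj; rewrite kh enum_rankK_in.
rewrite in_setXn negb_forall => /existsP[j jB].
by rewrite (bigD1 j) //= (negPf jB) !mul0r.
Qed.

Definition splice (p : nat) (d : 'I_p -> nat) (b : cell d) (j : 'I_p)
  (c : 'I_(d j)) : cell d := [ffun k => eqtype.dfwith b c k].

Lemma splice_eq (p : nat) (d : 'I_p -> nat) (b : cell d) (j : 'I_p)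
  (c : 'I_(d j)) : splice b c j = c.
Proof. by rewrite ffunE dfwith_in. Qed.

Lemma splice_neq (p : nat) (d : 'I_p -> nat) (b : cell d) (j k : 'I_p)
  (c : 'I_(d j)) : j != k -> splice b c k = b k.
Proof. by move=> jk; rewrite ffunE dfwith_out. Qed.

(** Relative to a base cell [b] of the box, [ln M] is the sum of its one-coordinate increments,
    because every parameter that does not vanish on the box depends there on at most one
    coordinate. *)
Lemma rank_one_on_box (R : realType) (p : nat) (d : 'I_p -> nat)
    (M : tensor R d) (theta : parameters R d) (B : forall j, {set 'I_(d j)})
    (free : {set 'I_p}) :
  (0 < p)%N -> log_linear M theta ->
  (forall j, j \notin free -> {in B j &, forall c c', c = c'}) ->
  (forall (E : {set 'I_p}) (i : cell d), i \in setXn B ->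
     theta E (restr E i) != 0 -> (#|E :&: free| <= 1)%N) ->
  rank_one_on M B.
Proof.
move=> p0 [_ ML] fixB freeB.
have [b bB|noB] := pickP (mem (setXn B)); last first.
  by exists (fun=> fun=> 0); split=> // i iB; move: (noB i); rewrite /= iB.
pose L (i : cell d) := ln (M i); pose j0 := Ordinal p0.
(* The constant [L b] must be counted once in the product; it is charged to [j0]. *)
exists (fun j c => expR (L (splice b c) - L b + L b *+ (j == j0))).
split=> [j c|i iB]; first exact: expR_ge0.
rewrite -expR_sum big_split /=.
have -> : \sum_(j < p) L b *+ (j == j0) = L b.
  by rewrite (bigD1 j0) //= big1 ?addr0 // => j /negPf ->.
suff -> : \sum_(j < p) (L (splice b (i j)) - L b) = L i - L b.
  by rewrite subrK lnK // posrE; case: (ML i).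
have LE k : L k = \sum_(E : {set 'I_p}) theta E (restr E k) by case: (ML k).
under eq_bigr do rewrite !LE -sumrB.
rewrite exchange_big /= !LE -sumrB; apply: eq_bigr => E _.
have eqr (k k' : cell d) : {in E, forall j, k j = k' j} -> restr E k = restr E k'.
  by move=> kk'; apply/ffunP => j; rewrite !ffunE kk' ?(valP j).
have spB j : splice b (i j) \in setXn B.
  apply/setXnP => k; rewrite ffunE.
  by case: eqtype.dfwithP => [|k' _]; [move/setXnP: iB | move/setXnP: bB]; apply.
have [le1|gt1] := leqP #|E :&: free| 1; last first.
  have th0 k : k \in setXn B -> theta E (restr E k) = 0.
    move=> kB; apply/eqP/negPn/negP => /(freeB _ _ kB).
    by rewrite leqNgt gt1.
  by rewrite !th0 // subr0 big1 // => j _; rewrite !th0 // subr0.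
have eqfix j : j \in E -> j \notin free -> i j = b j.
  by move=> _ /fixB; apply; [move/setXnP: iB | move/setXnP: bB]; apply.
(* [k] is the only coordinate of [E] that can vary on the box, or the filler [j0] if none can; only
   its increment survives in the sum. *)
have [k kE] : exists k, forall j, j \in E -> j \in free -> j = k.
  have [E0|[k kf]] := set_0Vmem (E :&: free).
    by exists j0 => j jE jf; have := finset.in_set0 j; rewrite -E0 inE jE jf.
  exists k => j jE jf; move/card_le1_eqP: le1; apply=> //.
  by rewrite inE jE jf.
rewrite (bigD1 k) //= big1 ?addr0 => [|j jk].
  congr (theta E _ - _); apply: eqr => j jE.
  have [<-|kj] := eqVneq k j; first by rewrite splice_eq.
  rewrite splice_neq // eqfix //; apply: contra_neqN kj => jf.
  by rewrite (kE j).
apply/eqP; rewrite subr_eq0; apply/eqP; congr (theta E _); apply: eqr => m mE.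
have [mj|jm] := eqVneq j m; last by rewrite splice_neq.
rewrite -mj splice_eq eqfix // ?mj //; apply: contra_neqN jk => jf.
by rewrite (kE j) // mj.
Qed.

(** * Boxes cut out by a covering family, and the two bounds *)

Definition level_options (p : nat) (d : 'I_p -> nat) : finType :=
  {dffun forall j : 'I_p, option 'I_(d j)}.

(* [None] stands for the merged class of all the levels outside [H j]. *)
Definition class_options (p : nat) (d : 'I_p -> nat) (H : level_sets d)
    (j : 'I_p) : {set option 'I_(d j)} :=
  None |: Some @: H j.

Definition level_class (p : nat) (d : 'I_p -> nat) (H : level_sets d)
    (g : level_options d) (j : 'I_p) : {set 'I_(d j)} :=
  if g j is Some c then [set c] else ~: H j.

Definition classify (p : nat) (d : 'I_p -> nat) (H : level_sets d)
    (i : cell d) : level_options d :=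
  [ffun j => if i j \in H j then Some (i j) else None].

Lemma card_class_options (p : nat) (d : 'I_p -> nat) (H : level_sets d) j :
  #|class_options H j| = (#|H j| + 1)%N.
Proof.
rewrite cardsU1 card_imset; last exact: Some_inj.
suff -> : None \notin Some @: H j by rewrite addnC.
by apply/negP => /imsetP[].
Qed.

Lemma Some_class_options (p : nat) (d : 'I_p -> nat) (H : level_sets d) j c :
  (Some c \in class_options H j) = (c \in H j).
Proof. by rewrite !inE /= mem_imset //; exact: Some_inj. Qed.

Lemma mem_class_options (p : nat) (d : 'I_p -> nat) (H : level_sets d) i j :
  classify H i j \in class_options H j.
Proof.
by rewrite ffunE; case: ifP => iH; rewrite ?Some_class_options // !inE.
Qed.

Lemma mem_level_class (p : nat) (d : 'I_p -> nat) (H : level_sets d)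
    (g : level_options d) (i : cell d) (j : 'I_p) :
  g j \in class_options H j ->
  (i j \in level_class H g j) = (g j == classify H i j).
Proof.
rewrite /level_class ffunE; case: (g j) => [c|_].
  rewrite Some_class_options inE => cH; have [ij|ij] := boolP (i j \in H j).
    by rewrite eq_sym.
  by apply: contraNF ij => /eqP ->.
by rewrite inE; case: ifP.
Qed.

Lemma level_class_subsingleton (p : nat) (d : 'I_p -> nat) (H : level_sets d)
    (g : level_options d) (j : 'I_p) :
  g j != None -> {in level_class H g j &, forall c c', c = c'}.
Proof.
rewrite /level_class; case: (g j) => // c _ x y.
by rewrite !inE => /eqP -> /eqP ->.
Qed.

(* If two coordinates of a nonzero interaction were free, the corresponding
   two-way interaction would be nonzero by hierarchy, yet untouched by [H]. *)
Lemma free_levels_le1 (R : realType) (p : nat) (d : 'I_p -> nat)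
    (theta : parameters R d) (H : level_sets d) (g : level_options d)
    (E : {set 'I_p}) (i : cell d) :
  weakly_hierarchical theta -> H \in covering theta ->
  i \in setXn (level_class H g) -> theta E (restr E i) != 0 ->
  (#|E :&: [set j | g j == None]| <= 1)%N.
Proof.
move=> wh; rewrite inE => /eqP Hcov /setXnP ig thE.
rewrite leqNgt; apply/negP; set F := E :&: _ => F2.
have thF : theta F (restr F i) != 0.
  apply: contra_neq thE => thF; apply: wh thF _ _ _ _; first exact: subsetIl.
  by move=> j jE jF; rewrite !ffunE.
have : Tagged (margin d) (restr F i) \in touched theta H.
  by rewrite Hcov inE /= F2.
rewrite inE => /andP[_ /existsP[[j jF]]] /=; rewrite ffunE /=.
have gj : g j = None by move: jF; rewrite !inE => /andP[_ /eqP].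
by move: (ig j); rewrite /level_class gj inE => /negPf ->.
Qed.

(** The class tuples index the boxes; the free coordinates of a box are those sent to [None], the
    other sides being singletons. *)
Lemma nonneg_parafac_bound (R : realType) (p : nat) (d : 'I_p -> nat)
    (M : tensor R d) (theta : parameters R d) (H : level_sets d) :
  (0 < p)%N -> log_linear M theta -> weakly_hierarchical theta ->
  H \in covering theta -> nonneg_parafac M (bound H).
Proof.
move=> p0 ll wh Hcov.
have -> : bound H = #|setXn (class_options H)|.
  by rewrite cardsXn; apply: eq_bigr => j _; rewrite card_class_options.
apply: (nonneg_parafac_boxes (B := level_class H) (h := classify H)).
- by move=> i; apply/setXnP => j; exact: mem_class_options.
- move=> i g /setXnP gH; apply/setXnP/eqP => [ig|-> j].
    apply/ffunP => j; apply/eqP; rewrite -mem_level_class; first exact: ig.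
    exact: gH.
  by rewrite mem_level_class ?mem_class_options.
move=> g _; apply: (rank_one_on_box (free := [set j | g j == None])) ll _ _ => //.
  by move=> j; rewrite inE => gj; exact: (level_class_subsingleton gj).
by move=> E i iB; exact: (free_levels_le1 wh Hcov).
Qed.

(* A class tuple with [g j != None] for all [j] outside [W] is a single cell, as
   only one level lies outside [H j] for [j] in [W]. The set [D] of these tuples
   can be dropped once the tuples which are [None] at [l] and [thin], i.e. have no
   other [None] outside [W], are enlarged to the full fiber along coordinate
   [l]: all the other coordinates being fixed, that fiber has rank one. *)
Lemma nonneg_parafac_sharp_bound (R : realType) (p : nat) (d : 'I_p -> nat)
    (M : tensor R d) (theta : parameters R d) (n : nat) (H : level_sets d)
    (l : 'I_p) :
  (forall j, d j = n) -> log_linear M theta -> weakly_hierarchical theta ->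
  H \in covering theta -> nonneg_parafac M (sharp_bound n H l).
Proof.
move=> dn ll wh Hcov; have p0 : (0 < p)%N := leq_ltn_trans (leq0n l) (ltn_ord l).
pose W := saturated_levels n H l.
pose C := setXn (class_options H).
pose D := setXn (fun j => if j \in W then class_options H j else Some @: H j).
have lW : l \notin W by rewrite !inE eqxx.
have DC : D \subset C.
  by apply: setXnS => j; case: ifP => // _; exact: finset.subsetUr.
have -> : sharp_bound n H l = #|C :\: D|.
  rewrite cardsD (finset.setIidPr DC) /sharp_bound -/W !cardsXn; congr (_ - _)%N.
    by apply: eq_bigr => j _; rewrite card_class_options.
  rewrite [RHS](bigID (mem W)) /=; congr (_ * _)%N.
    by apply: eq_bigr => j ->; rewrite card_class_options.
  apply: eq_big => j; first by rewrite inE.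
  rewrite inE => /negPf ->; rewrite card_imset //; exact: Some_inj.
pose thin (g : level_options d) :=
  [forall j, (j \notin W) ==> (j != l) ==> (g j != None)].
(* [thin] ignores the coordinate [l], so [drop] preserves it; a thin tuple is sent to the index of
   the fiber containing its box. *)
pose drop (g : level_options d) : level_options d :=
  [ffun j => if j == l then None else g j].
pose B (g : level_options d) j :=
  if thin g && (j == l) then [set: 'I_(d j)] else level_class H g j.
have thin_drop g : thin (drop g) = thin g.
  by apply: eq_forallb => j; rewrite ffunE; case: (j == l); rewrite ?implybT.
(* Within [C], lying in [D] means having no [None] outside [W], and [l] is outside [W]. *)
have D_def g : g \in C -> (g \in D) = thin g && (g l != None).
  move=> /setXnP gC; apply/setXnP/andP => [gD|[/forallP gt gl] j].
    have gN j : j \notin W -> g j != None.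
      move=> jW; move: (gD j); rewrite (negPf jW) => /imsetP[c _ ->//].
    split; last exact: gN.
    by apply/forallP => j; apply/implyP => /gN ->; rewrite implybT.
  case: ifP => // /negbT jW.
  have : g j != None.
    have [->//|jl] := eqVneq j l.
    by move: (gt j); rewrite jW jl.
  by move: (gC j); rewrite !inE => /predU1P[->|].
pose h i := if thin (classify H i) then drop (classify H i) else classify H i.
have cC i : classify H i \in C.
  by apply/setXnP => j; exact: mem_class_options.
have dropC g : g \in C -> drop g \in C.
  move=> /setXnP gC; apply/setXnP => j; rewrite ffunE.
  by case: ifP => _; [rewrite !inE | exact: gC].
have thinl g : thin g -> g \in C :\: D -> drop g = g.
  rewrite inE => gt /andP[+ gC]; rewrite D_def // gt negbK /= => /eqP gl.
  by apply/ffunP => j; rewrite ffunE; case: eqP => // ->.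
apply: (nonneg_parafac_boxes (B := B) (h := h)).
- move=> i; rewrite inE /h; case: ifP => ti.
    by rewrite D_def ?dropC // thin_drop ti ffunE !eqxx.
  by rewrite D_def // ti cC.
- move=> i g gCD; have /setXnP gC : g \in C by move: gCD; rewrite inE => /andP[].
  apply/setXnP/eqP => [iB|gh j]; last first.
    move: gh; rewrite /h /B; case: ifP => ti ->.
      rewrite thin_drop ti; case: eqP => [->|/eqP jl] /=; first by rewrite inE.
      by rewrite mem_level_class ffunE (negPf jl) ?mem_class_options.
    by rewrite ti /= mem_level_class ?mem_class_options.
  have [gt|gt] := boolP (thin g).
    have dg : g = drop (classify H i).
      rewrite -(thinl _ gt gCD); apply/ffunP => j; rewrite !ffunE.
      case: (eqVneq j l) => // jl; apply/eqP.
      move: (iB j); rewrite /B (negPf jl) andbF mem_level_class //.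
      by rewrite ffunE.
    by rewrite /h; move: gt; rewrite dg thin_drop => ->.
  have gi : g = classify H i.
    apply/ffunP => j; apply/eqP; move: (iB j).
    by rewrite /B (negPf gt) /= mem_level_class.
  by rewrite /h -gi (negPf gt).
move=> g gCD; have [gt|gt] := boolP (thin g).
  apply: (rank_one_on_box (free := [set l])) ll _ _ => //.
    move=> j; rewrite inE => jl; rewrite /B gt (negPf jl) /=.
    have [jW|jW] := boolP (j \in W); last first.
      have gj : g j != None by move/forallP/(_ j): gt; rewrite jW jl.
      exact: (level_class_subsingleton gj).
    have [gj|gj] := eqVneq (g j) None; last exact: (level_class_subsingleton gj).
    rewrite /level_class gj => c c' cH c'H.
    (* Saturation leaves [n - (n - 1)] levels outside [H j], which is at most 1 even for [n = 0]
       with truncated subtraction. *)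
    have /card_le1_eqP le1 : (#|~: H j| <= 1)%N.
      move: jW; rewrite !inE => /andP[_ /eqP Hj].
      rewrite cardsCs finset.setCK Hj card_ord dn.
      by case: (n) => // m; rewrite subSS subn0 subSnn.
    exact: le1.
  move=> E i _ _; apply: leq_trans (subset_leq_card (subsetIr _ _)) _.
  by rewrite cards1.
(* A tuple that is not thin keeps its original box, so the argument of the product bound applies. *)
apply: (rank_one_on_box (free := [set j | g j == None])) ll _ _ => //.
  move=> j; rewrite inE /B (negPf gt) => gj; exact: (level_class_subsingleton gj).
move=> E i; have -> : setXn (B g) = setXn (level_class H g).
  by apply: eq_setXn => j; rewrite /B (negPf gt).
by move=> iB; exact: (free_levels_le1 wh Hcov).
Qed.

(** * Passage to the minimum over covering families *)

(** Every interaction involves some coordinate. This witness makes the minima range over a nonempty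
    family, so the filler of [minover] is harmless. *)
Lemma setT_covering (R : realType) (p : nat) (d : 'I_p -> nat)
    (theta : parameters R d) :
  ([ffun j => [set: 'I_(d j)]] : level_sets d) \in covering theta.
Proof.
rewrite inE; apply/eqP/setP => -[E e]; rewrite inE.
apply: andb_idr; rewrite inE => /andP[/= E2 _].
have /set0Pn[j jE] : E != finset.set0 by rewrite -card_gt0 ltnW.
by apply/existsP; exists (exist _ j jE); rewrite ffunE inE.
Qed.

Lemma nonneg_rank_le_min_bound (R : realType) (p : nat) (d : 'I_p -> nat)
    (M : tensor R d) (theta : parameters R d) :
  (0 < p)%N -> log_linear M theta -> weakly_hierarchical theta ->
  (nonneg_rank M <= minover (fun H => H \in covering theta) (@bound p d))%N.
Proof.
move=> p0 ll wh; have M0 i : 0 <= M i by rewrite ltW //; case: (ll.2 i).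
have [_ min_rank] := nonneg_rankP p0 M0.
have [[H Hcov ->] _] := minoverP (@bound p d) (setT_covering theta).
by apply: min_rank; exact: (nonneg_parafac_bound p0 ll wh Hcov).
Qed.

Lemma nonneg_rank_le_min_sharp_bound (R : realType) (p : nat) (d : 'I_p -> nat)
    (M : tensor R d) (theta : parameters R d) (n : nat) :
  (0 < p)%N -> (forall j, d j = n) ->
  log_linear M theta -> weakly_hierarchical theta ->
  (nonneg_rank M <= minover (fun H => H \in covering theta) (fun H =>
     minover (fun _ : 'I_p => true) (fun l => sharp_bound n H l)))%N.
Proof.
move=> p0 dn ll wh; have M0 i : 0 <= M i by rewrite ltW //; case: (ll.2 i).
have [_ min_rank] := nonneg_rankP p0 M0.
have [[H Hcov ->] _] := minoverP (fun H : level_sets d =>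
  minover (fun _ : 'I_p => true) (fun l => sharp_bound n H l))
  (setT_covering theta).
have [[l _ ->] _] := @minoverP _ (fun _ : 'I_p => true)
  (fun l => sharp_bound n H l) (Ordinal p0) isT.
by apply: min_rank; exact: (nonneg_parafac_sharp_bound l dn ll wh Hcov).
Qed.

(** * Tightness on a 2 x 2 table *)

(** With [c] and [t] nonzero, the only zeros are those forced by the corner condition, and these
    pass to supersets, whence weak hierarchy. The constant [c] is left for normalization. *)
Definition uniform_parameters (R : realType) (p : nat) (d : 'I_p -> nat)
    (c t : R) : parameters R d := fun E e =>
  if [exists j, e j == 0%N :> nat] then 0 else if E == finset.set0 then c else t.

Definition nonreference (p : nat) (d : 'I_p -> nat) (i : cell d) : {set 'I_p} :=
  [set j | i j != 0%N :> nat].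

(* A cell with [k] non-reference coordinates sees [2 ^ k - 1] nonempty sets [E]. *)
Lemma sum_uniform_parameters (R : realType) (p : nat) (d : 'I_p -> nat)
    (c t : R) (i : cell d) :
  \sum_(E : {set 'I_p}) uniform_parameters c t (restr E i) =
  t *+ 2 ^ #|nonreference i| + (c - t).
Proof.
transitivity (\sum_(E in powerset (nonreference i))
    (t + (c - t) *+ (E == finset.set0))).
  rewrite [RHS]big_mkcond /=; apply: eq_bigr => E _.
  rewrite /uniform_parameters inE; case: existsP => [[[j jE]]|nE].
    rewrite ffunE /= => i0; case: ifP => // /fintype.subsetP/(_ j jE).
    by rewrite inE i0.
  case: fintype.subsetP => [_|[]].
    by case: eqP; rewrite ?addr0 // addrC subrK.
  move=> j jE; rewrite inE; apply: contra_notN nE => i0.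
  by exists (exist _ j jE); rewrite ffunE.
rewrite big_split /= sumr_const card_powerset; congr (_ + _).
rewrite (bigD1 finset.set0) ?powersetE ?finset.sub0set //= eqxx big1 ?addr0 //.
by move=> E /andP[_ /negPf ->].
Qed.

Lemma uniform_parameters_corner (R : realType) (p : nat) (d : 'I_p -> nat)
    (c t : R) : corner (@uniform_parameters R p d c t).
Proof.
move=> E e [j ej]; rewrite /uniform_parameters.
by case: existsP => // -[]; exists j; rewrite ej.
Qed.

Lemma uniform_parameters_neq0 (R : realType) (p : nat) (d : 'I_p -> nat)
    (c t : R) (E : {set 'I_p}) (e : margin d E) : c != 0 -> t != 0 ->
  (uniform_parameters c t e != 0) = [forall j, e j != 0%N :> nat].
Proof.
move=> c0 t0; rewrite -negb_exists /uniform_parameters.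
by case: existsP => [_|_]; rewrite ?eqxx //; case: ifP.
Qed.

Lemma uniform_parameters_weakly_hierarchical (R : realType) (p : nat)
    (d : 'I_p -> nat) (c t : R) : c != 0 -> t != 0 ->
  weakly_hierarchical (@uniform_parameters R p d c t).
Proof.
move=> c0 t0 E e /eqP e0 F f /fintype.subsetP EF fe; apply/eqP; move: e0.
apply: contraTT; rewrite !uniform_parameters_neq0 // => /forallP f0.
by apply/forallP => -[j jE]; rewrite -(fe _ _ (EF _ jE)); exact: f0.
Qed.

Definition uniform_tensor (R : realType) (p : nat) (d : 'I_p -> nat)
    (c t : R) : tensor R d :=
  fun i => expR (t *+ 2 ^ #|nonreference i| + (c - t)).

Lemma uniform_log_linear (R : realType) (p : nat) (d : 'I_p -> nat) (c t : R) :
  log_linear (@uniform_tensor R p d c t) (@uniform_parameters R p d c t).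
Proof.
split=> [|i]; first exact: uniform_parameters_corner.
by rewrite /uniform_tensor expR_gt0 expRK sum_uniform_parameters.
Qed.

Definition pair_cell (a b : 'I_2) : cell (fun _ : 'I_2 => 2%N) :=
  [ffun j => if j == ord0 then a else b].

Lemma card_nonreference_pair (a b : 'I_2) :
  #|nonreference (pair_cell a b)| = ((a != 0%N :> nat) + (b != 0%N :> nat))%N.
Proof.
rewrite -sum1dep_card big_mkcond !big_ord_recl big_ord0 !ffunE /= addn0.
by congr (_ + _)%N; case: eqP.
Qed.

Lemma rank_le1_minor (R : realType) (M : tensor R (fun _ : 'I_2 => 2%N))
    (k : nat) (a a' b b' : 'I_2) : (k <= 1)%N -> nonneg_parafac M k ->
  M (pair_cell a b) * M (pair_cell a' b') =
  M (pair_cell a b') * M (pair_cell a' b).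
Proof.
move=> k1 [mu [_ Mmu]]; rewrite !Mmu; case: k k1 mu Mmu => [|[|//]] _ mu _.
  by rewrite !big_ord0 !mul0r.
by rewrite !big_ord1 !big_ord_recl !big_ord0 !ffunE /= !mulr1; ring.
Qed.

(** The powers [2 ^ k] add up to 1 + 4 on the diagonal and 2 + 2 off it, so a vanishing minor would
    force [t = 0]. *)
Lemma uniform_rank_gt1 (R : realType) (c t : R) : t != 0 ->
  (1 < nonneg_rank (@uniform_tensor R 2 (fun _ => 2%N) c t))%N.
Proof.
move=> t0; have [rM _] := @nonneg_rankP R 2 _
  (@uniform_tensor R 2 (fun _ => 2%N) c t) isT (fun i => expR_ge0 _).
rewrite ltnNge; apply: contra_neqN t0 => r1.
have := rank_le1_minor ord0 ord_max ord0 ord_max r1 rM.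
rewrite /uniform_tensor !card_nonreference_pair /= -!expRD => /expR_inj /eqP.
rewrite -subr_eq0 => /eqP <-; rewrite !addn0 !add0n !expn0 !expn1; ring.
Qed.

Lemma tight_sharp_bound (R : realType) :
  exists (p n : nat) (pi : tensor R (fun _ : 'I_p => n))
      (theta : parameters R (fun _ : 'I_p => n)),
    (0 < p)%N /\
    probability_tensor pi /\
    log_linear pi theta /\
    weakly_hierarchical theta /\
    (forall j : 'I_p, interacting_levels theta j != finset.set0) /\
    nonneg_rank pi =
      minover (fun H => H \in covering theta) (fun H =>
        minover (fun _ : 'I_p => true) (fun l => sharp_bound n H l)).
Proof.
(* Any positive [t] would do: all unnormalized weights [F i] are then at least 1, so [Z > 1]. *)
pose t : R := ln 2; have t_gt0 : 0 < t by rewrite ln_gt0 // ltr1n.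
have t0 : t != 0 by rewrite gt_eqF.
pose d := fun _ : 'I_2 => 2%N.
pose F (i : cell d) := expR (t *+ 2 ^ #|nonreference i| - t).
have F1 i : 1 <= F i.
  rewrite -expR0 ler_expR subr_ge0 -{1}[t]mulr1n ler_wpMn2l ?(ltW t_gt0) //.
  by rewrite expn_gt0.
pose Z := \sum_i F i.
have Z1 : 1 < Z.
  pose i0 := pair_cell ord0 ord0; pose i1 := pair_cell ord0 ord_max.
  have i10 : i1 != i0 by apply/eqP => /ffunP/(_ ord_max); rewrite !ffunE.
  rewrite /Z (bigD1 i0) //= (bigD1 i1) //=; apply: le_lt_trans (F1 i0) _.
  rewrite ltrDl; apply: lt_le_trans (lt_le_trans ltr01 (F1 i1)) _.
  by rewrite lerDl; apply: sumr_ge0 => i _; exact: expR_ge0.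
pose c := - ln Z.
(* A zero parameter at the empty set would, by weak hierarchy, make all the others vanish. *)
have c0 : c != 0 by rewrite oppr_eq0; apply: lt0r_neq0; exact: ln_gt0.
pose M := @uniform_tensor R 2 d c t.
pose theta := @uniform_parameters R 2 d c t.
have ll : log_linear M theta := uniform_log_linear d c t.
have wh : weakly_hierarchical theta by exact: uniform_parameters_weakly_hierarchical.
exists 2%N, 2%N, M, theta; split; first by [].
split; last (split; first exact: ll); last (split; first exact: wh); last split.
- split=> [i|]; first exact: expR_ge0.
  transitivity (expR c * Z).
    by rewrite mulr_sumr; apply: eq_bigr => i _; rewrite -expRD; congr expR; ring.
  rewrite expRN lnK ?posrE ?(lt_trans ltr01 Z1) // mulVf // gt_eqF //.
  exact: lt_trans Z1.
- move=> j; apply/set0Pn; exists ord_max; rewrite inE.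
  (* Among two indices, [rev_ord j] is the one different from [j]. *)
  apply/existsP; exists (rev_ord j); apply/andP; split.
    by apply/negP => /eqP/(congr1 val)/=; case: j => [[|[]]].
  apply/existsP; exists ord_max.
  apply/existsP; exists [ffun=> ord_max]; rewrite !ffunE !eqxx /=.
  by rewrite uniform_parameters_neq0 //; apply/forallP => k; rewrite ffunE.
apply/eqP; rewrite eqn_leq nonneg_rank_le_min_sharp_bound //=.
apply: leq_trans (uniform_rank_gt1 c t0).
pose H : level_sets d := [ffun j => if j == ord0 then [set ord_max] else finset.set0].
have Hcov : H \in covering theta.
  rewrite inE; apply/eqP/setP => -[E e]; rewrite inE; apply: andb_idr.
  rewrite inE uniform_parameters_neq0 // => /andP[/= E2 /forallP e0].
  (* An interaction has at least two of the two variables, hence the first one, at its only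
     non-reference level [ord_max]. *)
  have E0 : ord0 \in E.
    have /eqP -> : E == [set: 'I_2] by rewrite eqEcard finset.subsetT cardsT card_ord.
    by rewrite inE.
  apply/existsP; exists (exist _ ord0 E0); rewrite ffunE /= inE.
  by move: (e0 (exist _ ord0 E0)); case: (e _) => -[|[|//]].
have [_ /(_ _ Hcov) leH] := minoverP (fun H : level_sets d =>
  minover (fun _ : 'I_2 => true) (fun l => sharp_bound 2 H l)) Hcov.
apply: leq_trans leH _.
have [_ /(_ ord0 isT) leHl] := @minoverP _ (fun _ : 'I_2 => true)
  (fun l => sharp_bound 2 H l) ord0 isT.
(* Discarding the subtracted product suffices: [bound H] is (1 + 1)(0 + 1) = 2. *)
apply: leq_trans leHl _; apply: leq_trans (leq_subr _ _) _.
by rewrite /bound !big_ord_recl big_ord0 !ffunE /= cards1 cards0.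
Qed.

Theorem theorem3p2 (R : realType) :
  (forall (p : nat) (d : 'I_p -> nat) (pi : tensor R d)
      (theta : parameters R d),
    (0 < p)%N ->
    probability_tensor pi ->
    log_linear pi theta ->
    weakly_hierarchical theta ->
    (forall j : 'I_p, interacting_levels theta j != finset.set0) ->
    (nonneg_rank pi <=
       minover (fun H => H \in covering theta) (fun H => bound H))%N /\
    (forall n : nat, (forall j : 'I_p, d j = n) ->
      (nonneg_rank pi <=
         minover (fun H => H \in covering theta) (fun H =>
           minover (fun _ : 'I_p => true) (fun l => sharp_bound n H l)))%N)) /\
  (exists (p n : nat) (pi : tensor R (fun _ : 'I_p => n))
      (theta : parameters R (fun _ : 'I_p => n)),
    (0 < p)%N /\
    probability_tensor pi /\
    log_linear pi theta /\
    weakly_hierarchical theta /\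
    (forall j : 'I_p, interacting_levels theta j != finset.set0) /\
    nonneg_rank pi =
      minover (fun H => H \in covering theta) (fun H =>
        minover (fun _ : 'I_p => true) (fun l => sharp_bound n H l))).
Proof.
split; last exact: tight_sharp_bound.
move=> p d pi theta p0 _ ll wh _; split=> [|n dn].
  exact: nonneg_rank_le_min_bound.
exact: nonneg_rank_le_min_sharp_bound.
Qed.
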